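(* Let $\mathbb{A}$ be a class of weakly saturated $\mathbf{FL_{ew}}$-chains such that for every $n\in\mathbb{N}$ there is some $\mathbf{A}_n\in\mathbb{A}$ that is not $n$-contractive. From each instance $P$ of the Post Correspondence Problem one can recursively define (that is, there is a computable map $P\mapsto\langle\Gamma_P,\varphi_P\rangle$ giving) a finite set of modal formulas $\Gamma_P\cup\{\varphi_P\}$ in three propositional variables such that the following are equivalent: (1) $P$ is satisfiable (i.e. $P$ has a solution); (2) $\Gamma_P\not\vdash_{K\mathbb{A}}\varphi_P$; (3) $\Gamma_P\not\vdash_{\omega K\mathbb{A}}\varphi_P$; (4) $\Gamma_P\not\vdash_{\mathbb{L}_{\mathbb{A}}}\varphi_P$.
   Context: An $\mathbf{FL_{ew}}$-algebra is a structure $\mathbf{A}=\langle A;\wedge,\vee,\cdot,\rightarrow,0,1\rangle$ where $\langle A;\wedge,\vee,0,1\rangle$ is a bounded lattice, $\langle A;\cdot,1\rangle$ is a commutative monoid, and $a\cdot b\le c$ iff $a\le b\rightarrow c$ for all $a,b,c$. Write $ab=a\cdot b$, $a^n$ for the $n$-fold product, $\neg a=a\rightarrow 0$, $a\leftrightarrow b=(a\rightarrow b)\cdot(b\rightarrow a)$. A chain is a linearly ordered $\mathbf{FL_{ew}}$-algebra. $\mathbf{A}$ is $n$-contractive if $a^{n+1}=a^n$ for all $a\in A$. $\mathbf{A}$ is weakly saturated if for all $a,b\in A$: if $a\le b^n$ for all $n\in\mathbb{N}$ then $ab=a$. Modal formulas (set $Fm$) are built from a countable set $\mathcal{V}$ of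 propositional variables using $\wedge,\vee,\cdot,\rightarrow,\neg,\overline{0},\overline{1}$ and unary $\Box,\Diamond$. A Kripke frame is a pair $\langle W,R\rangle$ with $W\neq\emptyset$ and $R\subseteq W\times W$. An $\mathbf{A}$-Kripke model is $\mathfrak{M}=\langle W,R,e\rangle$ with $\langle W,R\rangle$ a Kripke frame and $e:W\times\mathcal{V}\to A$, extended to formulas by interpreting propositional connectives and constants world-wise in $\mathbf{A}$ and $e(v,\Box\varphi)=\bigwedge_{Rvw}e(w,\varphi)$, $e(v,\Diamond\varphi)=\bigvee_{Rvw}e(w,\varphi)$. The model is safe if all these infima and suprema exist, for every formula and world. $\mathfrak{M}\models\varphi$ means $e(v,\varphi)=1$ for all $v\in W$; similarly for sets of formulas. For a class $\mathbb{C}$ of safe models and a finite set $\Gamma\cup\{\varphi\}$ of formulas, $\Gamma\vdash_{\mathbb{C}}\varphi$ (global consequence) means: for every $\mathfrak{M}\in\mathbb{C}$, $\mathfrak{M}\models\Gamma$ implies $\mathfrak{M}\models\varphi$. $K\mathbb{A}$ is the class of all safe $\mathbf{A}$-Kripke models with $\mathbf{A}\in\mathbb{A}$; $\omega K\mathbb{A}$ is the class of those with finite $W$. $\mathbb{L}$ is the class of all frames isomorphic to a finite chain $\langle\{1,\dots,k\},\{\langle i,i+1\rangle:1\le i<k\}\rangle$ for some $k\ge 1$, and $\vdash_{\mathbb{L}_{\mathbb{A}}}$ is the global consequence over all safe $\mathbf{A}$-Kripke models, $\mathbf{A}\in\mathbb{A}$, whose frame is in $\mathbb{L}$. Post Correspondence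 Problem: an instance $P$ is a finite list $\langle x_1,y_1\rangle,\dots,\langle x_n,y_n\rangle$ of pairs of positive integers written in some base $s\ge 2$. The concatenation of $x$ and $y$ in base $s$ is $x\,s^{\|y\|}+y$, where $\|y\|$ is the number of base-$s$ digits of $y$. A solution is a sequence of indices $i_1,\dots,i_k$ ($k\ge 1$, $1\le i_j\le n$) such that the concatenation of $x_{i_1},\dots,x_{i_k}$ equals the concatenation of $y_{i_1},\dots,y_{i_k}$. *)

(* Defs.v *)
From HB Require Import structures.
From Stdlib Require Cantor List.
From mathcomp Require Import all_boot all_order.
From mathcomp Require Import boolp classical_sets functions cardinality.

Set Implicit Arguments.
Unset Strict Implicit.
Unset Printing Implicit Defensive.

Import Order.TTheory.
Local Open Scope classical_set_scope.
Local Open Scope order_scope.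

(** * FL_ew-algebras *)

(* The constants 0 and 1 are the bounds \bot and \top of the lattice. *)
HB.mixin Record isFLew (d : Order.disp_t) A of Order.TBLattice d A := {
  flmul : A -> A -> A;
  flimp : A -> A -> A;
  flmulA : associative flmul;
  flmulC : commutative flmul;
  flmul1 : left_id (\top : A) flmul;
  flresiduation : forall a b c : A, (flmul a b <= c) = (a <= flimp b c)
}.

#[short(type="flewType")]
HB.structure Definition FLew (d : Order.disp_t) :=
  { A of isFLew d A & Order.TBLattice d A }.

Section FLewNotions.
Variables (d : Order.disp_t) (A : flewType d).

Definition flneg (a : A) : A := flimp a \bot.

Definition flexp (a : A) (n : nat) : A := iter n (flmul a) \top.

Definition is_chain : Prop := total (<=%O : rel A).

Definition n_contractive (n : nat) : Prop :=
  forall a : A, flexp a n.+1 = flexp a n.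

Definition weakly_saturated : Prop :=
  forall a b : A, (forall n, a <= flexp b n) -> flmul a b = a.

End FLewNotions.
Arguments is_chain {d} A.
Arguments n_contractive {d} A n.
Arguments weakly_saturated {d} A.

(** * Modal formulas *)

Inductive form : Type :=
| FVar of nat
| FZero
| FOne
| FAnd of form & form
| FOr of form & form
| FMul of form & form
| FImp of form & form
| FNeg of form
| FBox of form
| FDia of form.

Fixpoint form_vars (phi : form) : seq nat :=
  match phi with
  | FVar n => [:: n]
  | FZero | FOne => [::]
  | FAnd p q | FOr p q | FMul p q | FImp p q => form_vars p ++ form_vars q
  | FNeg p | FBox p | FDia p => form_vars p
  end.

(** * Kripke frames and models *)

Record kripke_frame : Type := KripkeFrame {
  world :> Type;
  acc : world -> set world;
  world_inhabited : inhabited world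
}.

Definition frame_iso (F G : kripke_frame) : Prop :=
  exists f : F -> G, bijective f /\ forall v w, acc v w <-> acc (f v) (f w).

(* The chain with k.+1 worlds, numbered from 0. *)
Definition chain_frame (k : nat) : kripke_frame :=
  @KripkeFrame 'I_k.+1 (fun i j => j = i.+1 :> nat) (inhabits ord0).

Record kripke_model (d : Order.disp_t) (A : flewType d) : Type := KripkeModel {
  frame_of :> kripke_frame;
  valuation : frame_of -> nat -> A
}.

Section Semantics.
Variables (d : Order.disp_t) (A : flewType d).

(* [infimum \top] and [supremum \bot] are correct on the empty set; they are
   arbitrary on a set without infimum (supremum), which [safe] excludes. *)
Fixpoint eval (M : kripke_model A) (v : M) (phi : form) : A :=
  match phi with
  | FVar n => valuation v n
  | FZero => \bot
  | FOne => \top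
  | FAnd p q => eval v p `&` eval v q
  | FOr p q => eval v p `|` eval v q
  | FMul p q => flmul (eval v p) (eval v q)
  | FImp p q => flimp (eval v p) (eval v q)
  | FNeg p => flneg (eval v p)
  | FBox p => infimum \top [set eval w p | w in acc v]
  | FDia p => supremum \bot [set eval w p | w in acc v]
  end.

Definition safe (M : kripke_model A) : Prop :=
  forall (phi : form) (v : M),
    infimums [set eval w phi | w in acc v] !=set0 /\
    supremums [set eval w phi | w in acc v] !=set0.

Definition models (M : kripke_model A) (phi : form) : Prop :=
  forall v : M, eval v phi = \top.

Definition models_all (M : kripke_model A) (Gamma : seq form) : Prop :=
  forall psi, List.In psi Gamma -> models M psi.

End Semantics.

Definition model_class (d : Order.disp_t) : Type :=
  forall A : flewType d, kripke_model A -> Prop.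

Definition consequence (d : Order.disp_t) (C : model_class d)
    (Gamma : seq form) (phi : form) : Prop :=
  forall (A : flewType d) (M : kripke_model A),
    C A M -> models_all M Gamma -> models M phi.

Definition K_class (d : Order.disp_t) (AA : flewType d -> Prop) :
    model_class d :=
  fun A M => AA A /\ safe M.

Definition omegaK_class (d : Order.disp_t) (AA : flewType d -> Prop) :
    model_class d :=
  fun A M => [/\ AA A, safe M & finite_set [set: M]].

Definition L_class (d : Order.disp_t) (AA : flewType d -> Prop) :
    model_class d :=
  fun A M => [/\ AA A, safe M & exists k, frame_iso (chain_frame k) M].

(** * The Post Correspondence Problem *)

Local Open Scope nat_scope.

Record pcp : Type := Pcp {
  pcp_base : nat;
  pcp_pairs : seq (nat * nat);
  pcp_base_ge2 : 2 <= pcp_base;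
  pcp_pairs_gt0 : all (fun p => (0 < p.1) && (0 < p.2)) pcp_pairs
}.

(* For [0 < y] and [2 <= s], y has j digits iff s ^ j.-1 <= y < s ^ j. *)
Definition num_digits (s y : nat) : nat := (trunc_log s y).+1.

Definition concat2 (s x y : nat) : nat := x * s ^ num_digits s y + y.

(* [concat2 s 0 y = y], so folding from 0 concatenates a nonempty sequence. *)
Definition concat (s : nat) (xs : seq nat) : nat := foldl (concat2 s) 0 xs.

Definition pcp_satisfiable (P : pcp) : Prop :=
  exists2 idx : seq 'I_(size (pcp_pairs P)), idx != [::] &
    concat (pcp_base P) [seq (tnth (in_tuple (pcp_pairs P)) i).1 | i <- idx] =
    concat (pcp_base P) [seq (tnth (in_tuple (pcp_pairs P)) i).2 | i <- idx].

(** * Computability *)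

(* Total recursive functions: the least class of functions on tuples of
   naturals containing zero, successor and projections and closed under
   composition, primitive recursion and minimization of regular functions. *)
Inductive recursive : forall k : nat, (k.-tuple nat -> nat) -> Prop :=
| rec_zero : recursive (fun _ : 0.-tuple nat => 0)
| rec_succ : recursive (fun v : 1.-tuple nat => (thead v).+1)
| rec_proj k (i : 'I_k) : recursive (fun v : k.-tuple nat => tnth v i)
| rec_comp k m (g : m.-tuple nat -> nat) (h : 'I_m -> k.-tuple nat -> nat) :
    recursive g -> (forall i, recursive (h i)) ->
    recursive (fun v => g [tuple h i v | i < m])
| rec_prim k (f : k.-tuple nat -> nat) (g : k.+2.-tuple nat -> nat)
    (h : k.+1.-tuple nat -> nat) :
    recursive f -> recursive g ->
    (forall v : k.-tuple nat, h [tuple of 0 :: v] = f v) ->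
    (forall n (v : k.-tuple nat),
       h [tuple of n.+1 :: v] = g [tuple of n :: h [tuple of n :: v] :: v]) ->
    recursive h
| rec_min k (f : k.+1.-tuple nat -> nat) (h : k.-tuple nat -> nat) :
    recursive f ->
    (forall v, f [tuple of h v :: v] = 0) ->
    (forall v n, n < h v -> f [tuple of n :: v] <> 0) ->
    recursive h
| rec_ext k (f g : k.-tuple nat -> nat) : recursive f -> f =1 g -> recursive g.

Definition code_pair (m n : nat) : nat := Cantor.to_nat (m, n).

Definition code_seq (T : Type) (code : T -> nat) (s : seq T) : nat :=
  foldr (fun x c => (code_pair (code x) c).+1) 0 s.

Fixpoint code_form (phi : form) : nat :=
  match phi with
  | FVar n => code_pair 0 n
  | FZero => code_pair 1 0
  | FOne => code_pair 2 0
  | FAnd p q => code_pair 3 (code_pair (code_form p) (code_form q))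
  | FOr p q => code_pair 4 (code_pair (code_form p) (code_form q))
  | FMul p q => code_pair 5 (code_pair (code_form p) (code_form q))
  | FImp p q => code_pair 6 (code_pair (code_form p) (code_form q))
  | FNeg p => code_pair 7 (code_form p)
  | FBox p => code_pair 8 (code_form p)
  | FDia p => code_pair 9 (code_form p)
  end.

Definition code_pcp (P : pcp) : nat :=
  code_pair (pcp_base P)
    (code_seq (fun p => code_pair p.1 p.2) (pcp_pairs P)).

Definition code_output (o : seq form * form) : nat :=
  code_pair (code_seq code_form o.1) (code_form o.2).

Definition computable_map (f : pcp -> seq form * form) : Prop :=
  exists2 g : 1.-tuple nat -> nat, recursive g &
    forall P : pcp, g [tuple code_pcp P] = code_output (f P).

(* Main.v *)
Require Import Defs.
From Stdlib Require List Cantor.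
From mathcomp Require Import all_boot all_order.
From mathcomp Require Import boolp classical_sets cardinality.
From mathcomp Require Import zify.

(** Let x, y, z be the variables 0, 1, 2. The premises make z constant
    along the accessibility relation, make x and y constant on the successors of
    each world, and say that, for some pair (a, b) of the instance,
    x = ([]x)^(s^|a|) z^a and y = ([]y)^(s^|b|) z^b. Since [] is 1 at a dead end,
    by induction a world from which a dead end can be reached has x = z^m and
    y = z^n, where m and n are the base-s concatenations of the two sides of one
    common sequence of pairs; a world from which no dead end can be reached has
    x <= z^n for all n, so xz = x by weak saturation. The conclusion
    (x <-> y) -> (x -> xz) holds in the latter case, and in the former as soon as
    m <> n. Conversely a solution with common value N yields a countermodel on a
    finite chain, with z an element such that z^(N+1) <> z^N. *)

Set Implicit Arguments.
Unset Strict Implicit.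
Unset Printing Implicit Defensive.

Import Order.TTheory.
Local Open Scope classical_set_scope.

(** * Recursive functions and Cantor codes *)

Lemma recursive_comp1 k (f : nat -> nat) (F : k.-tuple nat -> nat) :
  recursive (fun v : 1.-tuple nat => f (thead v)) -> recursive F ->
  recursive (fun v => f (F v)).
Proof.
move=> rf rF.
apply: (rec_ext (rec_comp (h := fun=> F) rf (fun=> rF))) => v.
by rewrite /thead tnth_mktuple.
Qed.

Lemma recursive_behead k (F : k.-tuple nat -> nat) :
  recursive F -> recursive (fun v : k.+1.-tuple nat => F (behead_tuple v)).
Proof.
move=> rF.
apply: (rec_ext (rec_comp rF (fun i => rec_proj (lift ord0 i)))) => v.
congr F; apply: eq_from_tnth => i.
rewrite tnth_mktuple tnth_behead; congr tnth; apply: val_inj.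
by rewrite /= inordK ?ltnS.
Qed.

Lemma recursive_thead k : recursive (fun v : k.+1.-tuple nat => thead v).
Proof. exact: rec_proj. Qed.

Lemma recursive_const k n : recursive (fun _ : k.-tuple nat => n).
Proof.
elim: n => [|n IHn]; last exact: (recursive_comp1 rec_succ IHn).
apply: (rec_ext (rec_comp (h := fun i : 'I_0 => fun=> 0) rec_zero _)) => //.
by case.
Qed.

Lemma behead_tuple_cons (T : Type) k (x : T) (v : k.-tuple T) :
  behead_tuple [tuple of x :: v] = v.
Proof. exact: val_inj. Qed.

(** [rec_prim] recurses on the first component of its argument; composing with the tuple [N v :: v]
    makes the number of steps a recursive function of the parameters. *)
Lemma recursive_nat_rect k (N A : k.-tuple nat -> nat)
    (S : nat -> nat -> k.-tuple nat -> nat) :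
  recursive N -> recursive A ->
  recursive (fun v : k.+2.-tuple nat =>
    S (thead v) (thead (behead_tuple v)) (behead_tuple (behead_tuple v))) ->
  recursive (fun v => nat_rect (fun=> nat) (A v) (fun i a => S i a v) (N v)).
Proof.
move=> rN rA rS.
pose H (w : k.+1.-tuple nat) :=
  nat_rect (fun=> nat) (A (behead_tuple w))
    (fun i a => S i a (behead_tuple w)) (thead w).
have rH : recursive H.
  by apply: (rec_prim rA rS) => [v|n v]; rewrite /H !behead_tuple_cons.
pose h (i : 'I_k.+1) (v : k.-tuple nat) :=
  if unlift ord0 i is Some j then tnth v j else N v.
have rh i : recursive (h i).
  by rewrite /h; case: unlift => [j|//]; apply: rec_proj.
apply: (rec_ext (rec_comp rH rh)) => v.
have -> : [tuple h i v | i < k.+1] = [tuple of N v :: v].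
  apply: eq_from_tnth => i; rewrite tnth_mktuple /h.
  by case: unliftP => [j ->|->]; rewrite ?tnthS ?tnth0.
by rewrite /H behead_tuple_cons theadE.
Qed.

Lemma recursive_iter k (N A : k.-tuple nat -> nat)
    (S : nat -> k.-tuple nat -> nat) :
  recursive N -> recursive A ->
  recursive (fun v : k.+1.-tuple nat => S (thead v) (behead_tuple v)) ->
  recursive (fun v => iter (N v) (S^~ v) (A v)).
Proof.
move=> rN rA rS.
apply: (recursive_nat_rect (S := fun _ a v => S a v)) => //.
exact: (recursive_behead rS).
Qed.

Lemma recursive_add k (F G : k.-tuple nat -> nat) :
  recursive F -> recursive G -> recursive (fun v => F v + G v).
Proof.
move=> rF rG.
apply: (rec_ext (recursive_iter (S := fun a _ => a.+1) rF rG _)).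
  exact: (recursive_comp1 rec_succ (recursive_thead _)).
by move=> v; rewrite iter_succn addnC.
Qed.

Lemma recursive_mul k (F G : k.-tuple nat -> nat) :
  recursive F -> recursive G -> recursive (fun v => F v * G v).
Proof.
move=> rF rG.
apply: (rec_ext (recursive_iter (S := fun a v => G v + a) rF (recursive_const _ 0) _)).
  exact: recursive_add (recursive_behead rG) (recursive_thead _).
by move=> v; rewrite iter_addn addn0 mulnC.
Qed.

Lemma recursive_pred k (F : k.-tuple nat -> nat) :
  recursive F -> recursive (fun v => (F v).-1).
Proof.
move=> rF.
apply: (rec_ext (recursive_nat_rect (S := fun i _ _ => i) rF (recursive_const _ 0) _)).
  exact: recursive_thead.
by move=> v; case: (F v).
Qed.

Lemma recursive_sub k (F G : k.-tuple nat -> nat) :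
  recursive F -> recursive G -> recursive (fun v => F v - G v).
Proof.
move=> rF rG.
apply: (rec_ext (recursive_iter (S := fun a _ => a.-1) rG rF _)).
  exact: recursive_pred (recursive_thead _).
by move=> v; rewrite iter_predn.
Qed.

(** Iterating the step that always returns [H v]: no iteration leaves [G v], any positive number
    gives [H v]. *)
Lemma recursive_if_eq0 k (F G H : k.-tuple nat -> nat) :
  recursive F -> recursive G -> recursive H ->
  recursive (fun v => if F v == 0 then G v else H v).
Proof.
move=> rF rG rH.
apply: (rec_ext (recursive_iter (S := fun _ => H) rF rG _)).
  exact: recursive_behead rH.
by move=> v; case: (F v).
Qed.

(** [m <= n] unfolds to [m - n == 0], so the test against zero applies by conversion. *)
Lemma recursive_if_leq k (F F' G H : k.-tuple nat -> nat) :
  recursive F -> recursive F' -> recursive G -> recursive H ->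
  recursive (fun v => if F v <= F' v then G v else H v).
Proof.
move=> rF rF' rG rH; exact: recursive_if_eq0 (recursive_sub rF rF') rG rH.
Qed.

(** * Cantor pairing and its inverses *)

(** The body copies the recursion inside [Cantor.to_nat], so that [code_pairE] holds by
    conversion. *)
Definition triangle (n : nat) : nat := nat_rect (fun=> nat) 0 (fun i m => i.+1 + m) n.

Lemma code_pairE m n : code_pair m n = n + triangle (n + m).
Proof. by []. Qed.

Lemma leq_triangle m n : m <= n -> triangle m <= triangle n.
Proof. by move/subnK <-; elim: (n - m) => //= i IHi; rewrite addSn /=; lia. Qed.

Lemma recursive_triangle k (F : k.-tuple nat -> nat) :
  recursive F -> recursive (fun v => triangle (F v)).
Proof.
move=> rF.
apply: (recursive_nat_rect (S := fun i m _ => i.+1 + m) rF (recursive_const _ 0)).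
apply: recursive_add; last exact: recursive_behead (recursive_thead _).
exact: recursive_comp1 rec_succ (recursive_thead _).
Qed.

Lemma recursive_code_pair k (F G : k.-tuple nat -> nat) :
  recursive F -> recursive G -> recursive (fun v => code_pair (F v) (G v)).
Proof.
move=> rF rG.
exact: recursive_add rG (recursive_triangle (recursive_add rG rF)).
Qed.

Definition decode_fst (n : nat) : nat := (Cantor.of_nat n).1.
Definition decode_snd (n : nat) : nat := (Cantor.of_nat n).2.
Definition diagonal (n : nat) : nat := decode_snd n + decode_fst n.

Lemma code_pairK1 m n : decode_fst (code_pair m n) = m.
Proof. by rewrite /decode_fst /code_pair Cantor.cancel_of_to. Qed.

Lemma code_pairK2 m n : decode_snd (code_pair m n) = n.
Proof. by rewrite /decode_snd /code_pair Cantor.cancel_of_to. Qed.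

Lemma decode_sndE n : decode_snd n + triangle (diagonal n) = n.
Proof.
by rewrite -code_pairE /code_pair -surjective_pairing Cantor.cancel_to_of.
Qed.

(* The diagonal of [n] is the least [d] with [n < triangle d.+1]. *)
Lemma recursive_diagonal k (F : k.-tuple nat -> nat) :
  recursive F -> recursive (fun v => diagonal (F v)).
Proof.
move=> rF.
apply: (rec_min (f := fun w : k.+1.-tuple nat =>
    (F (behead_tuple w)).+1 - triangle (thead w).+1)).
- apply: recursive_sub; first exact: recursive_comp1 rec_succ (recursive_behead rF).
  exact: recursive_triangle (recursive_comp1 rec_succ (recursive_thead _)).
- move=> v; rewrite behead_tuple_cons.
  rewrite theadE /=; have := decode_sndE (F v); rewrite /diagonal; lia.
- move=> v n ltn; rewrite behead_tuple_cons.
  rewrite theadE; have := leq_triangle ltn; have := decode_sndE (F v); lia.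
Qed.

Lemma recursive_decode_snd k (F : k.-tuple nat -> nat) :
  recursive F -> recursive (fun v => decode_snd (F v)).
Proof.
move=> rF.
apply: (rec_ext (recursive_sub rF (recursive_triangle (recursive_diagonal rF)))).
by move=> v; rewrite -{1}[F v]decode_sndE addnK.
Qed.

Lemma recursive_decode_fst k (F : k.-tuple nat -> nat) :
  recursive F -> recursive (fun v => decode_fst (F v)).
Proof.
move=> rF.
apply: (rec_ext (recursive_sub (recursive_diagonal rF) (recursive_decode_snd rF))).
by move=> v; rewrite addKn.
Qed.

(** * Left folds over coded lists *)

(* A state [code_pair l a] holds the code [l] of the list still to be read and
   the accumulator [a]. *)
Definition fold_step (G : nat -> nat -> nat) (st : nat) : nat :=
  if decode_fst st == 0 then st else
  code_pair (decode_snd (decode_fst st).-1)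
    (G (decode_snd st) (decode_fst (decode_fst st).-1)).

(** A state whose list is empty is fixed by the step, so any bound on the length will do as the
    number of iterations. *)
Lemma iter_fold_step (T : Type) (code : T -> nat) (G : nat -> nat -> nat) s n a :
  size s <= n ->
  iter n (fold_step G) (code_pair (code_seq code s) a) =
  code_pair 0 (foldl (fun b x => G b (code x)) a s).
Proof.
elim: n s a => [|n IHn] [|x s] a //= les.
- by rewrite -iterS iterSr {2}/fold_step code_pairK1 eqxx; apply: (IHn [::]).
- rewrite -iterS iterSr {2}/fold_step code_pairK1 /= code_pairK1 !code_pairK2.
  exact: IHn.
Qed.

Lemma size_code_seq (T : Type) (code : T -> nat) s : size s <= code_seq code s.
Proof.
elim: s => //= x s IHs; rewrite ltnS (leq_trans IHs) // code_pairE.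
exact: leq_addr.
Qed.

(** The list code itself bounds the length of the list and so serves as the iteration count. The
    value of [H] is specified only where [L] gives the code of a list over [T]. *)
Lemma recursive_foldl (T : Type) (code : T -> nat) k
    (G : nat -> nat -> k.-tuple nat -> nat) (A L : k.-tuple nat -> nat) :
  recursive (fun v : k.+2.-tuple nat =>
    G (thead v) (thead (behead_tuple v)) (behead_tuple (behead_tuple v))) ->
  recursive A -> recursive L ->
  exists2 H : k.-tuple nat -> nat, recursive H &
    forall v s, L v = code_seq code s ->
      H v = foldl (fun b x => G b (code x) v) (A v) s.
Proof.
move=> rG rA rL.
exists (fun v => decode_snd (iter (L v) (fold_step (fun b x => G b x v))
  (code_pair (L v) (A v)))).
  apply/recursive_decode_snd.
  apply: (recursive_iter (S := fun st v => fold_step (fun b x => G b x v) st)) => //.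
    exact: recursive_code_pair.
  have r1 := recursive_decode_fst (recursive_thead k).
  apply: recursive_if_eq0 => //; first exact: recursive_thead.
  apply: recursive_code_pair; first exact: recursive_decode_snd (recursive_pred r1).
  (* The arguments of [G] in one step: the accumulator, the head of the list still to be read, then
     the parameters. *)
  pose h (i : 'I_k.+2) (w : k.+1.-tuple nat) :=
    if unlift ord0 i is Some j then
      if unlift ord0 j is Some j' then tnth (behead_tuple w) j'
      else decode_fst (decode_fst (thead w)).-1
    else decode_snd (thead w).
  have rh i : recursive (h i).
    rewrite /h; case: unlift => [j|]; last first.
      exact: recursive_decode_snd (recursive_thead k).
    case: unlift => [j'|]; first exact: recursive_behead (rec_proj _).
    exact: recursive_decode_fst (recursive_pred r1).
  apply: (rec_ext (rec_comp rG rh)) => w.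
  have -> : [tuple h i w | i < k.+2] = [tuple of decode_snd (thead w) ::
      decode_fst (decode_fst (thead w)).-1 :: behead_tuple w].
    apply: eq_from_tnth => i; rewrite tnth_mktuple /h.
    case: unliftP => [j ->|->]; rewrite ?tnthS ?tnth0 //.
    by case: unliftP => [j' ->|->]; rewrite ?tnthS ?tnth0.
  by congr (G _ _ _); apply: val_inj.
move=> v s Ls; rewrite Ls iter_fold_step ?code_pairK2 //.
exact: size_code_seq.
Qed.

(** * The translation and its computability *)

(* Multiplying by [s] as long as the result is at most [y] avoids computing
   [trunc_log]. *)
Definition digit_scale (s y : nat) : nat :=
  iter y (fun p => if p <= y then s * p else p) 1.

(** After [n] rounds the exponent is [minn n (num_digits s y)], since the power grows exactly while
    it is at most [y]. From [trunc_log s y < s ^ trunc_log s y <= y] it follows that [y] rounds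
    suffice. *)
Lemma digit_scaleE s y : 1 < s -> 0 < y -> digit_scale s y = s ^ num_digits s y.
Proof.
move=> s_gt1 y_gt0; have s_gt0 := ltnW s_gt1.
suff iterE n : iter n (fun p => if p <= y then s * p else p) 1 =
    s ^ minn n (num_digits s y).
  rewrite /digit_scale iterE; congr (_ ^ _); apply/minn_idPr.
  by rewrite (leq_trans (ltn_expl _ s_gt1)) // trunc_logP.
elim: n => [|n IHn]; first by rewrite min0n.
rewrite iterS IHn; case: (leqP (num_digits s y) n) => [le_n|lt_n].
  rewrite (minn_idPr (leqW le_n)) leqNgt.
  by rewrite /num_digits trunc_log_ltn.
rewrite (minn_idPl lt_n) expnS.
by rewrite (leq_trans _ (trunc_logP s_gt1 y_gt0)) // leq_exp2l.
Qed.

Lemma recursive_digit_scale k (S Y : k.-tuple nat -> nat) :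
  recursive S -> recursive Y -> recursive (fun v => digit_scale (S v) (Y v)).
Proof.
move=> rS rY.
apply: (recursive_iter (S := fun p v => if p <= Y v then S v * p else p)) => //.
  exact: recursive_const.
apply: recursive_if_leq; try exact: recursive_thead.
  exact: recursive_behead.
exact: recursive_mul (recursive_behead rS) (recursive_thead _).
Qed.

(** * The formulas of the translation *)

Definition FPow (p : form) (n : nat) : form := iter n (FMul p) FOne.

Definition FIff (p q : form) : form := FMul (FImp p q) (FImp q p).

Definition recursive_form k (p : k.-tuple nat -> form) : Prop :=
  recursive (fun v => code_form (p v)).

Lemma recursive_form_and k (p q : k.-tuple nat -> form) :
  recursive_form p -> recursive_form q -> recursive_form (fun v => FAnd (p v) (q v)).
Proof.
move=> rp rq.
exact: recursive_code_pair (recursive_const _ 3) (recursive_code_pair rp rq).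
Qed.

Lemma recursive_form_mul k (p q : k.-tuple nat -> form) :
  recursive_form p -> recursive_form q -> recursive_form (fun v => FMul (p v) (q v)).
Proof.
move=> rp rq.
exact: recursive_code_pair (recursive_const _ 5) (recursive_code_pair rp rq).
Qed.

Lemma recursive_form_imp k (p q : k.-tuple nat -> form) :
  recursive_form p -> recursive_form q -> recursive_form (fun v => FImp (p v) (q v)).
Proof.
move=> rp rq.
exact: recursive_code_pair (recursive_const _ 6) (recursive_code_pair rp rq).
Qed.

Lemma recursive_form_iff k (p q : k.-tuple nat -> form) :
  recursive_form p -> recursive_form q -> recursive_form (fun v => FIff (p v) (q v)).
Proof. by move=> rp rq; apply: recursive_form_mul; apply: recursive_form_imp. Qed.

Lemma recursive_form_pow k (p : form) (N : k.-tuple nat -> nat) :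
  recursive N -> recursive_form (fun v => FPow p (N v)).
Proof.
move=> rN.
apply: (rec_ext (recursive_iter (N := N) (A := fun=> code_form FOne)
  (S := fun c _ => code_pair 5 (code_pair (code_form p) c)) _ _ _)) => //.
- exact: recursive_const.
- apply: recursive_code_pair (recursive_const _ _) (recursive_code_pair _ _).
    exact: recursive_const.
  exact: recursive_thead.
- by move=> v; elim: (N v) => // n IHn; rewrite iterS IHn.
Qed.

(** In exponents this is concatenation: where the box of [p] equals z^m, it forces [p] to be z
    raised to [concat2 s m x]. *)
Definition append_form (p : form) (s x : nat) : form :=
  FIff p (FMul (FPow (FBox p) (digit_scale s x)) (FPow (FVar 2) x)).

Definition pair_form (s x y : nat) : form :=
  FAnd (append_form (FVar 0) s x) (append_form (FVar 1) s y).

Lemma recursive_append_form k p (S X : k.-tuple nat -> nat) :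
  recursive S -> recursive X -> recursive_form (fun v => append_form p (S v) (X v)).
Proof.
move=> rS rX; apply: recursive_form_iff; first exact: recursive_const.
apply: recursive_form_mul; last exact: recursive_form_pow.
exact: recursive_form_pow (recursive_digit_scale rS rX).
Qed.

(** A left fold, so that [recursive_foldl] can compute its code. *)
Definition some_pair (s : nat) (l : seq (nat * nat)) : form :=
  foldl (fun q p => FOr (pair_form s p.1 p.2) q) FZero l.

(** The guard is top at a world with a successor and bottom at a dead end, where [FBox FZero] is
    top. *)
Definition if_successor (p : form) : form := FImp (FNeg (FBox FZero)) p.

(** Every successor value lies between the box and the diamond, so their equality makes [p] constant
    there. The guard exempts dead ends, where box is top and diamond is bottom. *)
Definition same_on_successors (p : form) : form :=
  if_successor (FIff (FBox p) (FDia p)).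

Definition successor_premises : seq form :=
  [:: same_on_successors (FVar 0); same_on_successors (FVar 1);
      same_on_successors (FVar 2);
      if_successor (FIff (FVar 2) (FBox (FVar 2)))].

Definition pcp_premises (P : pcp) : seq form :=
  some_pair (pcp_base P) (pcp_pairs P) :: successor_premises.

Definition pcp_conclusion : form :=
  FImp (FIff (FVar 0) (FVar 1)) (FImp (FVar 0) (FMul (FVar 0) (FVar 2))).

Definition pcp_translation (P : pcp) : seq form * form :=
  (pcp_premises P, pcp_conclusion).

(** This moves the fold from formulas to codes, with each pair read back from its code, as
    [recursive_foldl] requires. *)
Lemma code_some_pair s l :
  code_form (some_pair s l) =
  foldl (fun c n => code_pair 4 (code_pair
      (code_form (pair_form s (decode_fst n) (decode_snd n))) c))
    (code_form FZero) [seq code_pair p.1 p.2 | p <- l].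
Proof.
rewrite /some_pair; elim: l FZero => [//|p l IHl] q.
by rewrite [LHS]/= IHl [RHS]/= code_pairK1 code_pairK2.
Qed.

Lemma foldl_map (S T U : Type) (h : S -> T) (f : U -> T -> U) u s :
  foldl f u (map h s) = foldl (fun b x => f b (h x)) u s.
Proof. by elim: s u => /=. Qed.

(** Only the first premise depends on the instance; the other premises and the conclusion contribute
    constant codes. *)
Lemma computable_pcp_translation : computable_map pcp_translation.
Proof.
pose base (v : 1.-tuple nat) := decode_fst (thead v).
have rbase : recursive base by apply: recursive_decode_fst (recursive_thead _).
pose G c n v := code_pair 4 (code_pair
  (code_form (pair_form (base v) (decode_fst n) (decode_snd n))) c).
have [||H rH HE] := @recursive_foldl _ (fun p : nat * nat => code_pair p.1 p.2) 1
    G (fun=> code_form FZero) (fun v => decode_snd (thead v)) _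
    (recursive_const _ _) _.
- apply: recursive_code_pair; first exact: recursive_const.
  apply: recursive_code_pair; last exact: recursive_thead.
  have rb := recursive_behead (recursive_behead rbase).
  have rn := recursive_behead (recursive_thead 1).
  by apply: recursive_form_and; apply: recursive_append_form => //;
     [apply: recursive_decode_fst | apply: recursive_decode_snd].
- exact: recursive_decode_snd (recursive_thead _).
set rest := code_seq code_form successor_premises.
exists (fun v => code_pair (code_pair (H v) rest).+1 (code_form pcp_conclusion)).
  apply: recursive_code_pair (recursive_const _ _).
  exact: (recursive_comp1 rec_succ (recursive_code_pair rH (recursive_const _ _))).
move=> P; rewrite (HE _ (pcp_pairs P)); last by rewrite theadE code_pairK2.
rewrite /G /base theadE code_pairK1.
rewrite -(foldl_map (fun p : nat * nat => code_pair p.1 p.2) (fun c n =>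
  code_pair 4 (code_pair (code_form (pair_form _ (decode_fst n) (decode_snd n))) c))).
rewrite -code_some_pair.
reflexivity.
Qed.

Lemma form_vars_pow p n : all (fun x => x < 3) (form_vars p) ->
  all (fun x => x < 3) (form_vars (FPow p n)).
Proof. by move=> allp; elim: n => //= n IHn; rewrite all_cat allp. Qed.

Lemma form_vars_append p s x : all (fun x => x < 3) (form_vars p) ->
  all (fun x => x < 3) (form_vars (append_form p s x)).
Proof. by move=> allp; rewrite /= !all_cat /= !form_vars_pow // allp. Qed.

Lemma form_vars_translation P psi :
  List.In psi (pcp_conclusion :: pcp_premises P) ->
  all (fun x => x < 3) (form_vars psi).
Proof.
move=> [<- //|[<-|]]; last by do 4![case=> [<- //|]].
rewrite /some_pair.
have: all (fun x => x < 3) (form_vars FZero) by [].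
elim: (pcp_pairs P) FZero => //= p l IHl q allq; apply: IHl.
have -> : form_vars (FOr (pair_form (pcp_base P) p.1 p.2) q) =
  (form_vars (append_form (FVar 0) (pcp_base P) p.1) ++
   form_vars (append_form (FVar 1) (pcp_base P) p.2)) ++ form_vars q by [].
by rewrite all_cat all_cat allq !form_vars_append.
Qed.

(** * Algebra and evaluation *)

Lemma flmulr1 d (A : flewType d) (a : A) : flmul a \top%O = a.
Proof. by rewrite flmulC flmul1. Qed.

Lemma flmul_le2l d (A : flewType d) (a b c : A) :
  (a <= b)%O -> (flmul a c <= flmul b c)%O.
Proof. by rewrite flresiduation => /le_trans; apply; rewrite -flresiduation. Qed.

Lemma flmul_le2 d (A : flewType d) (a b c e : A) :
  (a <= b)%O -> (c <= e)%O -> (flmul a c <= flmul b e)%O.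
Proof.
move=> ab ce; apply: le_trans (flmul_le2l c ab) _.
by rewrite ![flmul b _]flmulC flmul_le2l.
Qed.

Lemma flmul_lel d (A : flewType d) (a b : A) : (flmul a b <= a)%O.
Proof. by rewrite -{2}[a]flmulr1 flmul_le2 ?lexx ?lex1. Qed.

Lemma flmul_eq1 d (A : flewType d) (a b : A) :
  flmul a b = \top%O <-> a = \top%O /\ b = \top%O.
Proof.
split=> [ab1|[-> ->]]; last exact: flmul1.
by split; apply/eqP; rewrite -le1x -ab1 ?flmul_lel // flmulC flmul_lel.
Qed.

Lemma flimp_eq1 d (A : flewType d) (a b : A) : flimp a b = \top%O <-> (a <= b)%O.
Proof.
rewrite -{2}[a]flmul1 flresiduation le1x.
by split=> [->|/eqP].
Qed.

Lemma fliff_eq1 d (A : flewType d) (a b : A) :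
  flmul (flimp a b) (flimp b a) = \top%O <-> a = b.
Proof.
rewrite flmul_eq1 !flimp_eq1; split=> [[ab ba]|->]; last by rewrite lexx.
by apply/eqP; rewrite eq_le ab.
Qed.

Lemma flneg1 d (A : flewType d) : flneg (\top : A)%O = \bot%O.
Proof. by apply/eqP; rewrite -lex0 -[X in (X <= _)%O]flmulr1 flresiduation. Qed.

Lemma flneg0 d (A : flewType d) : flneg (\bot : A)%O = \top%O.
Proof. by apply/flimp_eq1; rewrite le0x. Qed.

Lemma flimp1 d (A : flewType d) (a : A) : flimp \top%O a = \top%O <-> a = \top%O.
Proof. by rewrite flimp_eq1 le1x; split=> [/eqP|->]. Qed.

Lemma flimp0 d (A : flewType d) (a : A) : flimp \bot%O a = \top%O.
Proof. by apply/flimp_eq1; rewrite le0x. Qed.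

(** Linearity makes top join-prime; this turns the premise [some_pair] into the choice of a single
    pair. *)
Lemma chain_join_eq1 d (A : flewType d) (a b : A) : is_chain A ->
  (a `|` b)%O = \top%O <-> a = \top%O \/ b = \top%O.
Proof.
move=> chainA; split=> [|[] ->]; rewrite ?join1x ?joinx1 //.
by have /orP[/join_r|/join_l] := chainA a b => ->; [right|left].
Qed.

Lemma meet_eq1 d (A : flewType d) (a b : A) :
  (a `&` b)%O = \top%O <-> a = \top%O /\ b = \top%O.
Proof.
split=> [ab1|[-> ->]]; last exact: meetxx.
by split; apply/eqP; rewrite -le1x -ab1 ?leIl ?leIr.
Qed.

Lemma flmul_imp d (A : flewType d) (a b : A) : (flmul (flimp a b) a <= b)%O.
Proof. by rewrite flresiduation. Qed.

Lemma flexp1n d (A : flewType d) n : flexp (\top : A)%O n = \top%O.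
Proof. by elim: n => //= n IHn; rewrite flmul1. Qed.

Lemma flexpD d (A : flewType d) (a : A) m n :
  flexp a (m + n) = flmul (flexp a m) (flexp a n).
Proof. by elim: m => [|m IHm]; rewrite ?flmul1 // addSn /= IHm flmulA. Qed.

Lemma flexpM d (A : flewType d) (a : A) m n :
  flexp a (m * n) = flexp (flexp a m) n.
Proof. by elim: n => [|n IHn]; rewrite ?muln0 // mulnS flexpD IHn. Qed.

Lemma flexp_le d (A : flewType d) (a : A) m n :
  m <= n -> (flexp a n <= flexp a m)%O.
Proof. by move/subnKC <-; rewrite flexpD flmul_lel. Qed.

Lemma eval_pow d (A : flewType d) (M : kripke_model A) (v : M) p n :
  eval v (FPow p n) = flexp (eval v p) n.
Proof. by elim: n => //= n ->. Qed.

Lemma eval_append d (A : flewType d) (M : kripke_model A) (v : M) p s x :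
  1 < s -> 0 < x ->
  eval v (append_form p s x) = \top%O <->
  eval v p = flmul (flexp (eval v (FBox p)) (s ^ num_digits s x))
                   (flexp (valuation v 2) x).
Proof.
move=> s_gt1 x_gt0; rewrite -digit_scaleE // -eval_pow.
by rewrite -[valuation v 2]/(eval v (FVar 2)) -eval_pow; apply: fliff_eq1.
Qed.

(** The alternative [\bot = \top] is the trivial algebra, where even the initial [FZero] of the fold
    is top. *)
Lemma eval_some_pair d (A : flewType d) (M : kripke_model A) (v : M) s l :
  is_chain A -> eval v (some_pair s l) = \top%O <->
  (\bot : A)%O = \top%O \/ exists2 p, p \in l & eval v (pair_form s p.1 p.2) = \top%O.
Proof.
(* Reading bottom as the value of [FZero] lets the induction generalize over the starting formula of
   the fold. *)
move=> chainA; rewrite /some_pair -[\bot%O]/(eval v FZero).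
elim: l FZero => [|p l IHl] q.
  by split=> [|[|[]]] //; left.
rewrite [foldl _ _ _]/= IHl [eval v (FOr _ _)]/= -/(eval v (pair_form s p.1 p.2)).
rewrite chain_join_eq1 //.
split=> [[[p1|]|[p' p'l p'1]]|[|[p']]].
- by right; exists p => //; rewrite mem_head.
- by left.
- by right; exists p' => //; rewrite inE p'l orbT.
- by left; right.
rewrite inE => /orP[/eqP -> p1|p'l p'1]; first by left; left.
by right; exists p'.
Qed.

Lemma concat_rcons s xs x :
  concat s (rcons xs x) = concat s xs * s ^ num_digits s x + x.
Proof. by rewrite /concat foldl_rcons. Qed.

Lemma eval_box_dead_end d (A : flewType d) (M : kripke_model A) (v : M) p :
  acc v = set0 -> eval v (FBox p) = \top%O.
Proof. by move=> /= ->; rewrite image_set0 /infimum eqxx. Qed.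

(** Safety supplies an infimum, so the choice inside [infimum] returns a genuine lower bound and not
    the default. *)
Lemma eval_box_le d (A : flewType d) (M : kripke_model A) (v w : M) p :
  safe M -> acc v w -> (eval v (FBox p) <= eval w p)%O.
Proof.
move=> /(_ p v)[[x infx] _] vw; rewrite /= /infimum.
case: eqP => [E|_]; first by have : set0 (eval w p) by rewrite -E; exists w.
by case: xgetP => [y _ [lb _]|/(_ x) //]; apply: lb; exists w.
Qed.

Lemma eval_dia_ge d (A : flewType d) (M : kripke_model A) (v w : M) p :
  safe M -> acc v w -> (eval w p <= eval v (FDia p))%O.
Proof.
move=> /(_ p v)[_ [x supx]] vw; rewrite /= /supremum.
case: eqP => [E|_]; first by have : set0 (eval w p) by rewrite -E; exists w.
by case: xgetP => [y _ [ub _]|/(_ x) //]; apply: ub; exists w.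
Qed.

Lemma eval_if_successor_dead_end d (A : flewType d) (M : kripke_model A) (v : M) p :
  acc v = set0 -> eval v (if_successor p) = \top%O.
Proof.
move=> v0; rewrite /if_successor [LHS]/= -/(eval v (FBox FZero)).
by rewrite eval_box_dead_end // flneg1 flimp0.
Qed.

Lemma eval_if_successor d (A : flewType d) (M : kripke_model A) (v w : M) p :
  safe M -> acc v w -> eval v (if_successor p) = \top%O <-> eval v p = \top%O.
Proof.
move=> safeM vw; rewrite /if_successor [eval _ (FImp _ _)]/= -/(eval v (FBox FZero)).
have -> : eval v (FBox FZero) = \bot%O.
  by apply/eqP; rewrite -lex0 (eval_box_le FZero safeM vw).
by rewrite flneg0 flimp1.
Qed.

Lemma eval_same_on_successors d (A : flewType d) (M : kripke_model A) (v w : M) p :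
  safe M -> acc v w -> eval v (same_on_successors p) = \top%O ->
  eval v (FBox p) = eval w p.
Proof.
move=> safeM vw /(eval_if_successor _ safeM vw) /fliff_eq1 boxdia.
apply/eqP; rewrite eq_le (eval_box_le p safeM vw) /=.
by have := eval_dia_ge p safeM vw; rewrite /= -boxdia.
Qed.

(** * From countermodels to solutions *)

(** Whether a dead end is reachable is never asked. Induction on [n] shows instead that each world
    has x <= z^n or carries a sequence of pairs; a world with no sequence then satisfies the bound
    for every [n]. *)
Lemma satisfiable_of_countermodel d (A : flewType d) (M : kripke_model A) P :
  is_chain A -> weakly_saturated A -> safe M -> models_all M (pcp_premises P) ->
  ~ models M pcp_conclusion -> pcp_satisfiable P.
Proof.
move=> chainA satA safeM MG /existsNP[v Nconcl].
set s := pcp_base P; set l := in_tuple (pcp_pairs P).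
have s_gt1 : 1 < s := pcp_base_ge2 P.
pose val1 (idx : seq 'I_(size (pcp_pairs P))) := concat s [seq (tnth l i).1 | i <- idx].
pose val2 (idx : seq 'I_(size (pcp_pairs P))) := concat s [seq (tnth l i).2 | i <- idx].
have nontrivial : (\bot : A)%O <> \top%O.
  by move=> A01; apply: Nconcl; apply/eqP; rewrite -le1x -A01 le0x.
have step (w : M) : exists i,
  valuation w 0 = flmul (flexp (eval w (FBox (FVar 0))) (s ^ num_digits s (tnth l i).1))
    (flexp (valuation w 2) (tnth l i).1) /\
  valuation w 1 = flmul (flexp (eval w (FBox (FVar 1))) (s ^ num_digits s (tnth l i).2))
    (flexp (valuation w 2) (tnth l i).2).
  have: eval w (some_pair s (pcp_pairs P)) = \top%O by apply: MG; left.
  case/(eval_some_pair _ _ _ chainA) => // -[p /[dup] pl /(tnthP l)[i pE]] /meet_eq1[].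
  have /andP[p1 p2] := allP (pcp_pairs_gt0 P) p pl.
  move=> e1 e2; exists i; rewrite -pE.
  split; first exact: (proj1 (eval_append w (FVar 0) s_gt1 p1) e1).
  exact: (proj1 (eval_append w (FVar 1) s_gt1 p2) e2).
have tnth_gt0 i : 0 < (tnth l i).1.
  by have /andP[] := allP (pcp_pairs_gt0 P) _ (mem_tnth i l).
have path_or_small n (w : M) : (valuation w 0 <= flexp (valuation w 2) n)%O \/
  exists idx, [/\ idx != [::], valuation w 0 = flexp (valuation w 2) (val1 idx) &
    valuation w 1 = flexp (valuation w 2) (val2 idx)].
  elim: n w => [|n IHn] w; first by left; rewrite lex1.
  have [i [e0 e1]] := step w.
  (* At a dead end both boxes are top, and the concatenation of one word is that word. *)
  have [w0|/set0P[u wu]] := eqVneq (acc w) set0.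
    right; exists [:: i]; rewrite e0 e1 !eval_box_dead_end //.
    by rewrite !flexp1n !flmul1.
  have box k : k < 3 -> eval w (FBox (FVar k)) = valuation u k.
    move=> k3; apply: (eval_same_on_successors (p := FVar k) safeM wu).
    by apply: MG; case: k k3 => [|[|[|//]]] _; [do 1 right|do 2 right|do 3 right]; left.
  have zE : valuation w 2 = valuation u 2.
    rewrite -(box 2) //; apply/fliff_eq1.
    apply/(eval_if_successor (FIff (FVar 2) (FBox (FVar 2))) safeM wu).
    by apply: MG; do 4 right; left.
  rewrite !box // -?zE in e0 e1.
  have [small|[idx [_ x_idx y_idx]]] := IHn u; [left|right].
    (* Both exponents in [e0] are positive, so x at [w] is at most x at [u] times z, hence at most
       z^n z. *)
    rewrite e0 -[n.+1]addn1 flexpD flmul_le2 ?flexp_le //.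
    rewrite zE; apply: le_trans small; rewrite -{2}[valuation u 0]flmulr1.
    by apply: (@flexp_le _ _ _ 1); rewrite expn_gt0 ltnW.
  exists (rcons idx i); split; first by case: idx {x_idx y_idx}.
    by rewrite /val1 map_rcons concat_rcons flexpD flexpM e0 x_idx zE.
  by rewrite /val2 map_rcons concat_rcons flexpD flexpM e1 y_idx zE.
have [[idx [idx0 xE yE]]|none] := pselect (exists idx, [/\ idx != [::],
    valuation v 0 = flexp (valuation v 2) (val1 idx) &
    valuation v 1 = flexp (valuation v 2) (val2 idx)]); last first.
  (* Here x is below all powers of z, so xz = x by weak saturation and the inner implication is
     already top. *)
  case: Nconcl; apply/flimp_eq1; apply: le_trans (lex1 _) _; rewrite le1x; apply/eqP.
  apply/flimp_eq1; rewrite /= satA // => n.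
  by have [|/none] := path_or_small n v.
(* If the exponents m of x and n of y differed, the conclusion would hold at [v]. *)
exists idx => //; apply/eqP; apply: contra_notT Nconcl => neq.
apply/flimp_eq1; rewrite -flresiduation /=.
rewrite xE yE; have [lt12|lt21|/eqP] := ltngtP (val1 idx) (val2 idx).
(* For m < n: (x -> y)x <= y = z^n <= z^(m+1) = xz. *)
- apply: le_trans (flmul_le2l _ (flmul_lel _ _)) _.
  apply: le_trans (flmul_imp _ _) _.
  by rewrite flmulC; apply: (flexp_le _ lt12).
(* For n < m: x = y z^(m-n), so (y -> x)x = (y -> x)y z^(m-n) <= xz. *)
- apply: le_trans (flmul_le2l _ _) _.
    by rewrite flmulC; apply: flmul_lel.
  rewrite -{2}(subnKC (ltnW lt21)) flexpD flmulA flmul_le2 ?flmul_imp //.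
  by rewrite -[X in (_ <= X)%O]flmulr1; apply: (@flexp_le _ _ _ 1); rewrite subn_gt0.
- by rewrite (negPf neq).
Qed.

(** * Countermodels on chains *)

Lemma eval_unique_successor d (A : flewType d) (M : kripke_model A) (v w : M) p :
  acc v = [set w] -> eval v (FBox p) = eval w p /\ eval v (FDia p) = eval w p.
Proof.
move=> /= ->; rewrite image_set1 supremum1; split=> //.
have infs := infimums1 (eval w p); rewrite /infimum infs.
case: eqP => [E|_]; first by have : set0 (eval w p) by rewrite -E.
by case: xgetP => // /(_ (eval w p)) /(_ erefl).
Qed.

(** Sets of successor values are empty or singletons, so their bounds exist without any completeness
    of the algebra. *)
Lemma safe_deterministic d (A : flewType d) (M : kripke_model A) :
  (forall v : M, acc v = set0 \/ exists w, acc v = [set w]) -> safe M.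
Proof.
move=> det p v; have [->|[w ->]] := det v.
  rewrite image_set0; split; [exists \top%O|exists \bot%O];
    by split=> [x []|x _]; rewrite ?lex1 ?le0x.
by rewrite image_set1 infimums1 supremums1; split; exists (eval w p).
Qed.

Lemma chain_frame_acc k (v : chain_frame k) :
  (val v = k /\ acc v = set0) \/
  exists w : chain_frame k, val w = (val v).+1 /\ acc v = [set w].
Proof.
have : v < k.+1 by []; rewrite ltnS leq_eqVlt => /orP[/eqP vk|vk]; [left|right].
  split=> //; rewrite -subset0 => w /= wE.
  by have := ltn_ord w; rewrite [nat_of_ord w]wE vk ltnn.
exists (Ordinal (vk : v.+1 < k.+1)); split=> //.
by rewrite predeqE => w; split=> [wE|->//]; apply: val_inj.
Qed.

Lemma safe_chain_frame d (A : flewType d) k (e : chain_frame k -> nat -> A) :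
  safe (KripkeModel e).
Proof.
apply: safe_deterministic => v.
by have [[_ ->]|[w [_ ->]]] := chain_frame_acc v; [left|right; exists w].
Qed.

(* World [j] carries the concatenation of all but the last [j] words. *)
Definition solution_valuation d (A : flewType d) (c : A) s (xs ys : seq nat) k
    (j : chain_frame k) (n : nat) : A :=
  let e l := flexp c (concat s (take (k.+1 - val j) l)) in
  match n with 0 => e xs | 1 => e ys | _ => c end.

(** At the root x = y = z^N for the common value N, so the conclusion would give z^N <= z^(N+1),
    against the choice of [c]. Each step along the chain drops the last word, and the dead end keeps
    only the first. *)
Lemma countermodel_of_solution d (A : flewType d) (P : pcp) (c : A)
    (idx : seq 'I_(size (pcp_pairs P))) :
  let s := pcp_base P in
  let xs := [seq (tnth (in_tuple (pcp_pairs P)) i).1 | i <- idx] in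
  let ys := [seq (tnth (in_tuple (pcp_pairs P)) i).2 | i <- idx] in
  is_chain A -> idx != [::] -> concat s xs = concat s ys ->
  flexp c (concat s xs).+1 <> flexp c (concat s xs) ->
  let M := KripkeModel (solution_valuation c s xs ys (k := (size idx).-1)) in
  models_all M (pcp_premises P) /\ ~ models M pcp_conclusion.
Proof.
move=> s xs ys chainA idx0 eq_xy Nc M.
have safeM : safe M by exact: safe_chain_frame.
set k := (size idx).-1 in M safeM *.
have sz_idx : size idx = k.+1 by rewrite prednK // lt0n size_eq0.
have sz_xs : size xs = k.+1 by rewrite size_map.
have sz_ys : size ys = k.+1 by rewrite size_map.
split; last first.
  pose r : M := ord0.
  have xE : eval r (FVar 0) = flexp c (concat s xs).
    by rewrite /= /solution_valuation subn0 -sz_xs take_size.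
  have yE : eval r (FVar 1) = eval r (FVar 0).
    by rewrite xE /= /solution_valuation subn0 -sz_ys take_size eq_xy.
  move=> /(_ r); have -> : eval r pcp_conclusion =
    flimp (eval r (FIff (FVar 0) (FVar 1)))
      (flimp (eval r (FVar 0)) (flmul (eval r (FVar 0)) c)) by [].
  have -> : eval r (FIff (FVar 0) (FVar 1)) = \top%O by exact/fliff_eq1/esym.
  rewrite flimp1 xE => /flimp_eq1 le_c; apply: Nc.
  by apply/eqP; rewrite eq_le flexp_le //= flmulC le_c.
(* This covers the dead end too: no word is taken there, and the zeroth power is top, as is the
   box. *)
have box (v : M) n : n < 2 ->
    eval v (FBox (FVar n)) =
    flexp c (concat s (take (k - val v) (if n == 0 then xs else ys))).
  have [[vk v0]|[w [wE vw]]] := chain_frame_acc v => n2.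
    by rewrite (@eval_box_dead_end _ _ M) // vk subnn take0.
  rewrite (proj1 (@eval_unique_successor _ _ M _ _ _ vw)) /=.
  by case: n n2 => [|[|//]] _; rewrite /= wE subSS.
(* World [v] uses [k.+1 - v] words and its box [k - v], so the word appended at [v] has index
   [k - v]. *)
have step (v : M) p (l : seq nat) : size l = k.+1 -> all (leq 1) l ->
    eval v p = flexp c (concat s (take (k.+1 - val v) l)) ->
    eval v (FBox p) = flexp c (concat s (take (k - val v) l)) ->
    eval v (append_form p s (nth 0 l (k - val v))) = \top%O.
  move=> sz_l l_gt0 pE boxE.
  have lt_v : k - val v < size l by rewrite sz_l ltnS leq_subr.
  apply/eval_append; rewrite ?pcp_base_ge2 //; first exact: all_nthP l_gt0 _ lt_v.
  have le_v : val v <= k by rewrite -ltnS; apply: ltn_ord.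
  by rewrite pE boxE subSn // (take_nth 0 lt_v) concat_rcons flexpD flexpM.
(* With a single successor, box and diamond agree on every formula; at the dead end the guard is
   bottom. *)
have same (v : M) p : eval v (same_on_successors p) = \top%O.
  have [[_ v0]|[w [_ vw]]] := chain_frame_acc v.
    exact: (@eval_if_successor_dead_end _ _ M).
  have vw' : acc v w by rewrite vw.
  apply/(@eval_if_successor _ _ M _ _ _ safeM vw')/fliff_eq1.
  have [boxE diaE] := @eval_unique_successor _ _ M _ _ p vw.
  exact: etrans boxE (esym diaE).
move=> psi [<-|[<-|[<-|[<-|[<-|//]]]]] v //.
- apply/eval_some_pair => //; right.
  have i0 : 'I_(size (pcp_pairs P)) by case: (idx) idx0.
  have lt_v : k - val v < size idx by rewrite sz_idx ltnS leq_subr.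
  have gt0 i := allP (pcp_pairs_gt0 P) _ (mem_tnth i (in_tuple (pcp_pairs P))).
  (* The true disjunct at [v] is the pair that contributes the last word used at [v]. *)
  exists (tnth (in_tuple (pcp_pairs P)) (nth i0 idx (k - val v))).
    exact: mem_tnth.
  have := step v (FVar 0) xs sz_xs; have := step v (FVar 1) ys sz_ys.
  rewrite !(nth_map i0) // !box // => step1 step0.
  have xs_gt0 : all (leq 1) xs.
    by rewrite all_map; apply/allP => i _; have /andP[] := gt0 i.
  have ys_gt0 : all (leq 1) ys.
    by rewrite all_map; apply/allP => i _; have /andP[] := gt0 i.
  by apply/meet_eq1; split; [apply: step0 | apply: step1].
- have [[_ v0]|[w [_ vw]]] := chain_frame_acc v.
    exact: (@eval_if_successor_dead_end _ _ M).
  have vw' : acc v w by rewrite vw.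
  apply/(@eval_if_successor _ _ M _ _ _ safeM vw')/fliff_eq1.
  exact/esym/(proj1 (@eval_unique_successor _ _ M _ _ (FVar 2) vw)).
Qed.

Lemma finite_of_chain_frame_iso k (F : kripke_frame) :
  frame_iso (chain_frame k) F -> finite_set [set: F].
Proof.
move=> [f [[g fK gK] _]].
have -> : [set: F] = f @` [set: 'I_k.+1].
  by rewrite predeqE => w; split=> // _; exists (g w).
exact: finite_image.
Qed.

(** * The equivalence of the four conditions *)

Theorem theorem3p2 (d : Order.disp_t) (AA : flewType d -> Prop)
    (AA_chain : forall A : flewType d, AA A -> is_chain A)
    (AA_weakly_saturated : forall A : flewType d, AA A -> weakly_saturated A)
    (AA_not_contractive : forall n : nat,
      exists2 A : flewType d, AA A & ~ n_contractive A n) :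
  exists2 f : pcp -> seq form * form, computable_map f &
    forall P : pcp,
      let Gamma := (f P).1 in
      let phi := (f P).2 in
      (forall psi, List.In psi (phi :: Gamma) ->
         all (fun x => x < 3) (form_vars psi)) /\
      [<-> pcp_satisfiable P;
           ~ consequence (K_class AA) Gamma phi;
           ~ consequence (omegaK_class AA) Gamma phi;
           ~ consequence (L_class AA) Gamma phi].
Proof.
exists pcp_translation; first exact: computable_pcp_translation.
move=> P Gamma phi; split; first exact: form_vars_translation.
have sat_L : pcp_satisfiable P -> ~ consequence (L_class AA) Gamma phi.
  move=> [idx idx0 eq_xy] LGphi.
  (* Failure of contractivity is taken at the common value N of the solution, giving [c] with
     c^(N+1) different from c^N. *)
  have [A AA_A /existsNP[c Nc]] := AA_not_contractive
    (concat (pcp_base P) [seq (tnth (in_tuple (pcp_pairs P)) i).1 | i <- idx]).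
  have [MG] := countermodel_of_solution (AA_chain A AA_A) idx0 eq_xy Nc; apply.
  apply: LGphi MG; split=> //; first exact: safe_chain_frame.
  by exists (size idx).-1, id; split=> //; exists id.
(* The model classes are nested, finite chains being finite frames, so a countermodel in a smaller
   class serves in a larger one. *)
have L_omega : ~ consequence (L_class AA) Gamma phi ->
    ~ consequence (omegaK_class AA) Gamma phi.
  move=> + omega; apply=> A M [AA_A safeM [k isoM]]; apply: omega.
  by split=> //; apply: finite_of_chain_frame_iso isoM.
have omega_K : ~ consequence (omegaK_class AA) Gamma phi ->
    ~ consequence (K_class AA) Gamma phi.
  by move=> + K; apply=> A M [AA_A safeM _]; apply: K.
have K_sat : ~ consequence (K_class AA) Gamma phi -> pcp_satisfiable P.
  apply: contra_notP => Nsat A M [AA_A safeM] MG.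
  apply: contrapT => Nphi; apply: Nsat.
  exact: satisfiable_of_countermodel (AA_chain A AA_A)
    (AA_weakly_saturated A AA_A) safeM MG Nphi.
tfae.
- by move=> sat; apply/omega_K/L_omega/sat_L.
- by move=> K; apply/L_omega/sat_L/K_sat.
- by move=> omega; apply/sat_L/K_sat/omega_K.
- by move=> L; apply/K_sat/omega_K/L_omega.
Qed.
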